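(* Let $\theta=[\mathrm{vec}(A)^T,\mu^T]^T,\ \theta_0=[\mathrm{vec}(A_0)^T,\mu_0^T]^T\in\mathscr{D}(p,r)$ with $M=M(\mu)$ and $M_0=M(\mu_0)$ positive definite. If $$\|\Sigma(\theta)-\Sigma(\theta_0)\|_F\le\frac{(1-\|A_0\|_2^2)^2\lambda_r(M_0)}{4\sqrt2(1+\|A_0\|_2^2)^2},$$ then $$\|\theta-\theta_0\|_2\le\Big[1+\frac{16\sqrt2\{1+\lambda_1(M_0)\}(1+\|A_0\|_2^2)}{\lambda_r(M_0)(1-\|A_0\|_2^2)}\Big]\|\Sigma(\theta)-\Sigma(\theta_0)\|_F .$$
   Context: Fix integers $1\le r\le p$. For $A\in\mathbb{R}^{(p-r)\times r}$ write $\varphi=\mathrm{vec}(A)$, $X_\varphi=\begin{bmatrix}0_{r\times r}&-A^{T}\\ A&0\end{bmatrix}$, $I_{p\times r}=\begin{bmatrix}I_r\\0\end{bmatrix}$, and let $U(\varphi)=(I_p+X_\varphi)(I_p-X_\varphi)^{-1}I_{p\times r}$ be the Cayley parameterization. For a symmetric $r\times r$ matrix $M$, $\mathrm{vech}(M)$ stacks its on-and-below-diagonal entries column by column, and $M(\mu)$ is the symmetric matrix with $\mathrm{vech}(M(\mu))=\mu$. $\mathscr{D}(p,r)=\{\theta=[\mathrm{vec}(A)^T,\mu^T]^T:\|A\|_2<1,\ \mu\in\mathbb{R}^{r(r+1)/2}\}$ and $\Sigma(\theta)=U(\varphi)M(\mu)U(\varphi)^T$. $\lambda_1(M_0)\ge\dots\ge\lambda_r(M_0)>0$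 are the eigenvalues of the positive definite matrix $M_0$. *)

(* Defs.v *)
From HB Require Import structures.
From mathcomp Require Import all_boot all_order all_algebra.
From mathcomp Require Import classical_sets reals.
Set Implicit Arguments. Unset Strict Implicit. Unset Printing Implicit Defensive.
Import Order.TTheory GRing.Theory Num.Theory.
Local Open Scope ring_scope.
Local Open Scope classical_set_scope.

Section Defs.
Variable R : realType.

Definition vnorm2 n (x : 'cV[R]_n) : R := Num.sqrt (\sum_i (x i 0) ^+ 2).

Definition seqnorm2 (s : seq R) : R := Num.sqrt (\sum_(a <- s) a ^+ 2).

Definition frob m n (A : 'M[R]_(m, n)) : R :=
  Num.sqrt (\sum_i \sum_j (A i j) ^+ 2).

Definition specnorm m n (A : 'M[R]_(m, n)) : R :=
  sup [set vnorm2 (A *m x) | x in [set x : 'cV[R]_n | vnorm2 x <= 1]].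

(* largest / smallest eigenvalue (used for symmetric matrices, whose
   eigenvalues are all real) *)
Definition lambda_max n (M : 'M[R]_n) : R := sup [set a : R | eigenvalue M a].
Definition lambda_min n (M : 'M[R]_n) : R := inf [set a : R | eigenvalue M a].

Definition posdef n (M : 'M[R]_n) : Prop :=
  M^T = M /\ forall x : 'cV[R]_n, x != 0 -> 0 < (x^T *m M *m x) 0 0.

Definition vecm m n (A : 'M[R]_(m, n)) : seq R :=
  [seq A i j | j <- enum 'I_n, i <- enum 'I_m].

Definition vech n (M : 'M[R]_n) : seq R :=
  flatten [seq [seq M i j | i <- [seq i <- enum 'I_n | (nat_of_ord j <= nat_of_ord i)%N]] | j <- enum 'I_n].

Definition theta_of r q (A : 'M[R]_(q, r)) (M : 'M[R]_r) : seq R :=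
  vecm A ++ vech M.

Definition Xphi r q (A : 'M[R]_(q, r)) : 'M[R]_(r + q) :=
  block_mx 0 (- A^T) A 0.

Definition Ipr r q : 'M[R]_(r + q, r) := col_mx 1%:M 0.

Definition Ucay r q (A : 'M[R]_(q, r)) : 'M[R]_(r + q, r) :=
  (1%:M + Xphi A) *m invmx (1%:M - Xphi A) *m Ipr r q.

Definition Sigma r q (A : 'M[R]_(q, r)) (M : 'M[R]_r) : 'M[R]_(r + q) :=
  Ucay A *m M *m (Ucay A)^T.

End Defs.

(* Main.v *)
(* Write [U = Ucay A], [P = U U^T], and [X], [Y] for the top blocks of [Ucay A],
   [Ucay A0]; both are symmetric, and their eigenvalues are [(1 - s^2) / (1 + s^2)]
   for the singular values [s] of [A], [A0], so [X >= 0] and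
   [Y >= c := (1 - a0) / (1 + a0)]. Let [d] be the distance of the two [Sigma].
   - From [(1 - P) Sigma0 U0 = (1 - P) U0 M0] one gets
     [lambda_min M0 * |(1 - P) U0| <= d], without any eigenvalue perturbation theorem.
   - The aligning matrix [V = U0^T U] satisfies a Sylvester equation
     [(1 - V) X + Y (1 - V) = O(|(1 - P) U0|)] whose left-hand side dominates
     [c * |1 - V|]; hence [c * |U - U0| <= 4 * |(1 - P) U0|].
   - [|A - A0| <= 2 |U - U0|], and [|M - M0| <= d + 2 lambda_max M0 * |U - U0|]
     since [M = U^T Sigma U].
   This gives the bound with [8] in place of [16 sqrt 2]. *)
Require Import Defs.
From HB Require Import structures.
From mathcomp Require Import all_boot all_order all_algebra.
From mathcomp Require Import ring lra.
From mathcomp Require Import classical_sets reals.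
Import Order.TTheory GRing.Theory Num.Theory.
Local Open Scope ring_scope.

Set Implicit Arguments. Unset Strict Implicit. Unset Printing Implicit Defensive.

(** * Frobenius inner product, positive semidefinite forms and contractions *)

Section FrobeniusInnerProduct.
Variable R : realType.

Definition fdot m n (A B : 'M[R]_(m, n)) : R := \tr (A^T *m B).

Lemma fdotE m n (A B : 'M[R]_(m, n)) : fdot A B = \sum_i \sum_j A i j * B i j.
Proof.
rewrite /fdot /mxtrace exchange_big /=; apply: eq_bigr => j _.
by rewrite mxE; apply: eq_bigr => i _; rewrite mxE.
Qed.

Lemma fdotC m n (A B : 'M[R]_(m, n)) : fdot A B = fdot B A.
Proof. by rewrite /fdot -mxtrace_tr trmx_mul trmxK. Qed.

Lemma fdotDr m n (A B C : 'M[R]_(m, n)) : fdot A (B + C) = fdot A B + fdot A C.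
Proof. by rewrite /fdot mulmxDr mxtraceD. Qed.

Lemma fdotNr m n (A B : 'M[R]_(m, n)) : fdot A (- B) = - fdot A B.
Proof. by rewrite /fdot mulmxN raddfN. Qed.

Lemma fdotZr m n (A : 'M[R]_(m, n)) k (B : 'M_(m, n)) :
  fdot A (k *: B) = k * fdot A B.
Proof. by rewrite /fdot -scalemxAr mxtraceZ. Qed.

Lemma fdotDl m n (A B C : 'M[R]_(m, n)) : fdot (A + B) C = fdot A C + fdot B C.
Proof. by rewrite fdotC fdotDr !(fdotC C). Qed.

Lemma fdotNl m n (A B : 'M[R]_(m, n)) : fdot (- A) B = - fdot A B.
Proof. by rewrite fdotC fdotNr fdotC. Qed.

Lemma fdotZl m n k (A B : 'M[R]_(m, n)) : fdot (k *: A) B = k * fdot A B.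
Proof. by rewrite fdotC fdotZr fdotC. Qed.

Definition fdot_lin := (fdotDl, fdotDr, fdotNl, fdotNr, fdotZl, fdotZr).

Lemma fdot_mull m n p (N : 'M[R]_(m, n)) (A : 'M_(n, p)) B :
  fdot (N *m A) B = fdot A (N^T *m B).
Proof. by rewrite /fdot trmx_mul mulmxA. Qed.

Lemma fdot_tr m n (A B : 'M[R]_(m, n)) : fdot A^T B^T = fdot A B.
Proof. by rewrite [LHS]fdotC /fdot trmxK mxtrace_mulC. Qed.

Lemma fdot_ge0 m n (A : 'M[R]_(m, n)) : 0 <= fdot A A.
Proof. by rewrite fdotE; do 2![apply: sumr_ge0 => ? _]; rewrite -expr2 sqr_ge0. Qed.

Lemma fdot_eq0 m n (A : 'M[R]_(m, n)) : fdot A A = 0 -> A = 0.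
Proof.
rewrite fdotE => /eqP.
rewrite psumr_eq0 => [/allP h|i _]; last first.
  by apply: sumr_ge0 => j _; rewrite -expr2 sqr_ge0.
apply/matrixP => i j; rewrite mxE; apply/eqP.
have := h i; rewrite mem_index_enum => /(_ isT).
rewrite /= psumr_eq0 => [/allP/(_ j)|k _]; last by rewrite -expr2 sqr_ge0.
by rewrite mem_index_enum => /(_ isT) /=; rewrite mulf_eq0 orbb.
Qed.

Lemma frob_ge0 m n (A : 'M[R]_(m, n)) : 0 <= frob A.
Proof. exact: sqrtr_ge0. Qed.

Lemma frobE m n (A : 'M[R]_(m, n)) : frob A = Num.sqrt (fdot A A).
Proof.
by rewrite fdotE; congr Num.sqrt; do 2![apply: eq_bigr => ? _]; rewrite expr2.
Qed.

Lemma frob_sq m n (A : 'M[R]_(m, n)) : frob A ^+ 2 = fdot A A.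
Proof. by rewrite frobE sqr_sqrtr ?fdot_ge0. Qed.

Lemma frob_tr m n (A : 'M[R]_(m, n)) : frob A^T = frob A.
Proof. by rewrite !frobE fdot_tr. Qed.

Lemma frobN m n (A : 'M[R]_(m, n)) : frob (- A) = frob A.
Proof. by rewrite !frobE !fdot_lin opprK. Qed.

Lemma quadratic_discr (a b c : R) :
  0 <= c -> (forall t, 0 <= a + 2 * b * t + c * t ^+ 2) -> b ^+ 2 <= a * c.
Proof.
rewrite le_eqVlt => /predU1P[<- h|c0 h].
  have [->|b0] := eqVneq b 0; first by rewrite mulr0 expr2 mulr0.
  (* With [c = 0] and [b != 0] the function is affine and nonconstant; this [t] makes it equal to
     [-1]. *)
  have := h (- (a + 1) / (2 * b)).
  have -> : a + 2 * b * (- (a + 1) / (2 * b)) + 0 * (- (a + 1) / (2 * b)) ^+ 2 = -1.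
    by field.
  by rewrite lerNr oppr0 ler10.
(* The vertex of the parabola, where the minimum is [(a * c - b ^+ 2) / c]. *)
have := h (- b / c).
have -> : a + 2 * b * (- b / c) + c * (- b / c) ^+ 2 = (a * c - b ^+ 2) / c.
  by field; rewrite gt_eqF.
by rewrite pmulr_lge0 ?invr_gt0 // subr_ge0.
Qed.

(** Testing against matrices with any number of columns gives Frobenius-norm inequalities directly;
    [psd_cols] reduces it to single columns. Symmetry is a separate hypothesis. *)
Definition psd n (N : 'M[R]_n) := forall m (B : 'M[R]_(n, m)), 0 <= fdot B (N *m B).

Lemma psd_cols n (N : 'M[R]_n) : (forall x : 'cV[R]_n, 0 <= fdot x (N *m x)) -> psd N.
Proof.
move=> h m B; rewrite fdotE exchange_big /=; apply: sumr_ge0 => j _.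
have := h (col j B); rewrite fdotE; congr (0 <= _); apply: eq_bigr => i _.
by rewrite big_ord1 !mxE; congr (_ * _); apply: eq_bigr => k _; rewrite mxE.
Qed.

(** Cauchy-Schwarz for the semi-inner product [<A, N B>]: the form at [A + t B] is a nonnegative
    quadratic in [t]. *)
Lemma psd_cauchy n m (N : 'M[R]_n) (A B : 'M_(n, m)) :
  N^T = N -> psd N ->
  fdot A (N *m B) ^+ 2 <= fdot A (N *m A) * fdot B (N *m B).
Proof.
move=> sN pN; apply: quadratic_discr => // t.
have := pN _ (A + t *: B); rewrite mulmxDr -scalemxAr !fdot_lin.
have -> : fdot B (N *m A) = fdot A (N *m B) by rewrite fdotC fdot_mull sN.
by congr (0 <= _); ring.
Qed.

Lemma fdot_cauchy m n (A B : 'M[R]_(m, n)) : fdot A B <= frob A * frob B.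
Proof.
apply: le_trans (ler_norm _) _.
rewrite -[leRHS]ger0_norm ?mulr_ge0 ?frob_ge0 // -ler_sqr ?nnegrE // !real_normK ?num_real //.
rewrite exprMn !frob_sq; have := @psd_cauchy m n 1%:M A B (trmx1 _ _).
by rewrite !mul1mx; apply => k C; rewrite mul1mx fdot_ge0.
Qed.

Lemma frobD m n (A B : 'M[R]_(m, n)) : frob (A + B) <= frob A + frob B.
Proof.
rewrite -ler_sqr ?nnegrE ?addr_ge0 ?frob_ge0 //.
rewrite sqrrD !frob_sq !fdot_lin (fdotC B A).
have := fdot_cauchy A B; lra.
Qed.

Lemma frobB m n (A B : 'M[R]_(m, n)) : frob (A - B) <= frob A + frob B.
Proof. by rewrite -(frobN B) frobD. Qed.

Lemma frob_le m n p q (A : 'M[R]_(m, n)) (B : 'M[R]_(p, q)) k :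
  0 <= k -> fdot A A <= k ^+ 2 * fdot B B -> frob A <= k * frob B.
Proof.
move=> k0 h; rewrite -ler_sqr ?nnegrE ?mulr_ge0 ?frob_ge0 //.
by rewrite exprMn !frob_sq.
Qed.

Lemma frob_isom m n p (C : 'M[R]_(m, n)) (B : 'M_(n, p)) :
  C^T *m C = 1%:M -> frob (C *m B) = frob B.
Proof. by move=> h; rewrite !frobE fdot_mull mulmxA h mul1mx. Qed.

(** Pythagoras for the orthogonal projection [C C^T]; it makes both [C^T] and [1 - C C^T]
    contractions. *)
Lemma fdot_proj m n p (C : 'M[R]_(m, n)) (B : 'M_(m, p)) :
  C^T *m C = 1%:M ->
  fdot (B - C *m (C^T *m B)) (B - C *m (C^T *m B)) + fdot (C^T *m B) (C^T *m B)
    = fdot B B.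
Proof.
move=> h; rewrite !fdot_lin; set z := C^T *m B.
have zz : fdot (C *m z) (C *m z) = fdot z z by rewrite fdot_mull mulmxA h mul1mx.
have zB : fdot (C *m z) B = fdot z z by rewrite fdot_mull.
by rewrite zz (fdotC B) zB; ring.
Qed.

Lemma frob_coisom m n p (C : 'M[R]_(m, n)) (B : 'M_(m, p)) :
  C^T *m C = 1%:M -> frob (C^T *m B) <= frob B.
Proof.
move=> /fdot_proj h; rewrite !frobE ler_sqrt ?fdot_ge0 // -(h _ B).
by rewrite lerDr fdot_ge0.
Qed.

Lemma frob_coproj m n p (C : 'M[R]_(m, n)) (B : 'M_(m, p)) :
  C^T *m C = 1%:M -> frob (B - C *m (C^T *m B)) <= frob B.
Proof.
move=> /fdot_proj h; rewrite !frobE ler_sqrt ?fdot_ge0 // -(h _ B).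
by rewrite lerDl fdot_ge0.
Qed.

(** Turns a right factor into a left one, so that the estimates for left multiplication apply. *)
Lemma frob_mulr m n p (B : 'M[R]_(m, n)) (C : 'M_(n, p)) :
  frob (B *m C) = frob (C^T *m B^T).
Proof. by rewrite -frob_tr trmx_mul. Qed.

Lemma frob_mul_col m n (A : 'M[R]_(m, n)) (x : 'cV_n) :
  frob (A *m x) <= frob A * frob x.
Proof.
apply: frob_le; rewrite ?frob_ge0 // frob_sq !(fdotE A A) fdotE mulr_suml.
apply: ler_sum => i _; rewrite big_ord1 -expr2.
have -> : (A *m x) i 0 = fdot (row i A)^T x.
  by rewrite fdotE mxE; apply: eq_bigr => k _; rewrite big_ord1 !mxE.
rewrite -real_normK ?num_real //.
have -> : \sum_j A i j * A i j = frob (row i A)^T ^+ 2.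
  by rewrite frob_sq fdotE; apply: eq_bigr => k _; rewrite big_ord1 !mxE.
rewrite -frob_sq -exprMn ler_sqr ?nnegrE ?mulr_ge0 ?frob_ge0 // ler_norml fdot_cauchy.
by rewrite andbT lerNl -fdotNl -(frobN (row i A)^T) fdot_cauchy.
Qed.

(** This is [N^2 <= k N] for [0 <= N <= k]. With [u = |N B|^2], Cauchy-Schwarz for the form of [N]
    at [B] and [N B] gives [u^2 <= v w], and [w <= k u]; then divide by [u]. *)
Lemma psd_sq_le n m (N : 'M[R]_n) k (B : 'M_(n, m)) :
  N^T = N -> psd N -> psd (k%:M - N) ->
  fdot (N *m B) (N *m B) <= k * fdot B (N *m B).
Proof.
move=> sN pN pk; have := psd_cauchy B (N *m B) sN pN.
have := pk _ (N *m B); rewrite mulmxBl mul_scalar_mx !fdot_lin.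
have -> : fdot B (N *m (N *m B)) = fdot (N *m B) (N *m B).
  by rewrite [RHS]fdot_mull sN.
set u := fdot (N *m B) (N *m B); have u0 : 0 <= u by exact: fdot_ge0.
set v := fdot B (N *m B); have v0 : 0 <= v by exact: pN.
set w := fdot _ _ => h1 h2.
(* If [u = 0], only [0 <= k v] is left; a negative [k] forces [v = 0], since [0 <= v <= k |B|^2]. *)
move: u0; rewrite le_eqVlt => /predU1P[u0|u0].
  rewrite -u0; have [k0|k0] := leP 0 k; first exact: mulr_ge0.
  have := pk _ B; rewrite mulmxBl mul_scalar_mx !fdot_lin -/v => h3.
  have := fdot_ge0 B => h4; nra.
rewrite -(ler_pM2r u0) -expr2 (le_trans h2) //; nra.
Qed.

Lemma frob_psd_le n m (N : 'M[R]_n) k (B : 'M_(n, m)) :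
  N^T = N -> psd N -> psd (k%:M - N) -> 0 <= k -> frob (N *m B) <= k * frob B.
Proof.
move=> sN pN pk k0; apply: frob_le => //.
apply: le_trans (psd_sq_le _ sN pN pk) _.
have := pk _ B; rewrite mulmxBl mul_scalar_mx !fdot_lin => h.
rewrite expr2 -mulrA ler_wpM2l //; lra.
Qed.

(** Cauchy-Schwarz gives [k |B|^2 <= <B, N B> <= |B| |N B|]; divide by [|B|]. *)
Lemma frob_psd_ge n m (N : 'M[R]_n) k (B : 'M_(n, m)) :
  psd (N - k%:M) -> k * frob B <= frob (N *m B).
Proof.
move=> /(_ _ B); rewrite mulmxBl mul_scalar_mx !fdot_lin -frob_sq => h.
have := fdot_cauchy B (N *m B) => h2.
have := frob_ge0 B; rewrite le_eqVlt => /predU1P[b0|b0].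
  by rewrite -b0 mulr0 frob_ge0.
rewrite -(ler_pM2l b0); nra.
Qed.

Lemma unitmx_inj n (N : 'M[R]_n) : (forall x : 'cV_n, N *m x = 0 -> x = 0) -> N \in unitmx.
Proof.
move=> h; rewrite -unitmx_tr -row_free_unit -kermx_eq0; apply/eqP/row_matrixP => i.
rewrite row0; apply: trmx_inj; rewrite trmx0; apply: h.
apply: trmx_inj; rewrite trmx_mul trmxK trmx0.
by apply/sub_kermxP; rewrite row_sub.
Qed.

Lemma unitmx_coercive n (N : 'M[R]_n) :
  (forall x : 'cV_n, fdot x x <= fdot x (N *m x)) -> N \in unitmx.
Proof.
move=> h; apply: unitmx_inj => x Nx; apply: fdot_eq0; apply: le_anti.
by rewrite fdot_ge0 andbT (le_trans (h x)) // Nx /fdot mulmx0 mxtrace0.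
Qed.

End FrobeniusInnerProduct.

(** * Extreme eigenvalues of symmetric matrices *)

Section Spectrum.
Variable R : realType.

Lemma eigenvalue_symP n (N : 'M[R]_n) a : N^T = N ->
  reflect (exists2 x : 'cV_n, N *m x = a *: x & x != 0) (eigenvalue N a).
Proof.
move=> sN; apply: (iffP eigenvalueP) => -[x Nx x0]; exists x^T.
- by rewrite -{1}sN -trmx_mul Nx linearZ.
- by rewrite -trmx0 (inj_eq trmx_inj).
- by rewrite -{1}sN -trmx_mul Nx linearZ.
- by rewrite -trmx0 (inj_eq trmx_inj).
Qed.

Lemma fdot_mul_le n (N : 'M[R]_n) (x : 'cV_n) : fdot x (N *m x) <= frob N * fdot x x.
Proof.
apply: le_trans (fdot_cauchy _ _) _; rewrite -frob_sq expr2 mulrCA.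
by rewrite ler_wpM2l ?frob_ge0 ?frob_mul_col.
Qed.

(** Homogeneity: normalizing [x] passes from Rayleigh quotients on the unit sphere to the quadratic
    form. *)
Lemma psd_shift_unit n (N : 'M[R]_n) k :
  (forall x : 'cV_n, fdot x x = 1 -> k <= fdot x (N *m x)) <-> psd (N - k%:M).
Proof.
split=> [h|pk x x1]; last first.
  by have := pk _ x; rewrite mulmxBl mul_scalar_mx !fdot_lin x1 mulr1 subr_ge0.
apply: psd_cols => x; rewrite mulmxBl mul_scalar_mx !fdot_lin subr_ge0.
have [x0|x0] := eqVneq (fdot x x) 0.
  by rewrite (fdot_eq0 x0) /fdot !mulmx0 mxtrace0 mulr0.
have s0 : frob x != 0 by rewrite -sqrf_eq0 frob_sq.
have := h ((frob x)^-1 *: x); rewrite -scalemxAr !fdot_lin -frob_sq.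
rewrite mulrA -expr2 exprVn mulVf ?sqrf_eq0 // => /(_ erefl).
have -> : (frob x)^-1 * ((frob x)^-1 * fdot x (N *m x)) = fdot x (N *m x) / frob x ^+ 2.
  by field.
by rewrite ler_pdivlMr // exprn_gt0 // lt_def s0 frob_ge0.
Qed.

(* If [mu] is the infimum of the Rayleigh quotient and [L := N - mu] were
   invertible, then [|x|^2 <= C |L x|^2 <= C' <x, L x>] would bound the quotient
   away from [mu]; so no compactness argument is needed. *)
Lemma rayleigh_min n (N : 'M[R]_n) : (0 < n)%N -> N^T = N ->
  exists2 mu, eigenvalue N mu & psd (N - mu%:M).
Proof.
move=> n0 sN.
pose S := [set fdot x (N *m x) | x in [set x : 'cV[R]_n | fdot x x = 1]]%classic.
have S0 : (S !=set0)%classic.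
  pose d : 'cV[R]_n := delta_mx (Ordinal n0) 0.
  exists (fdot d (N *m d)); exists d => //=.
  by rewrite /fdot trmx_delta mul_delta_mx trace_mx11 mxE !eqxx.
have lS : has_lbound S.
  exists (- frob N) => _ [x /= x1 <-].
  by rewrite lerNl -fdotNr -mulNmx (le_trans (fdot_mul_le _ _)) // x1 mulr1 frobN.
have pL : psd (N - (inf S)%:M).
  by apply/psd_shift_unit => x x1; apply: ge_inf => //; exists x.
exists (inf S) => //; set L := N - _ in pL.
have sL : L^T = L by rewrite /L linearB /= tr_scalar_mx sN.
apply: contraT => noeig.
have uL : L \in unitmx.
  apply: unitmx_inj => x Lx; apply/eqP; apply: contraNT noeig => x0.
  apply/(eigenvalue_symP _ sN); exists x => //.
  by apply/eqP; rewrite -subr_eq0 -mul_scalar_mx -mulmxBl -/L Lx.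
have kL : psd ((frob L)%:M - L).
  apply: psd_cols => x; rewrite mulmxBl mul_scalar_mx !fdot_lin subr_ge0.
  exact: fdot_mul_le.
(* The factor [frob L] comes from [psd_sq_le], [|L x|^2 <= |L| <x, L x>]; the summand [1] makes [C]
   positive at once. *)
pose C := frob (invmx L) ^+ 2 * frob L + 1.
have C0 : 0 < C by rewrite ltr_wpDl // mulr_ge0 ?frob_ge0 // exprn_ge0 ?frob_ge0.
have : inf S + C^-1 <= inf S.
  apply: lb_le_inf => // _ [x /= x1 <-].
  have h1 := psd_sq_le x sL pL kL.
  have h2 : 1 <= frob (invmx L) ^+ 2 * fdot (L *m x) (L *m x).
    rewrite -x1 -[in leLHS](mulKmx uL x) -!frob_sq -exprMn.
    by rewrite ler_sqr ?nnegrE ?mulr_ge0 ?frob_ge0 // frob_mul_col.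
  have h3 := pL _ x.
  have h4 : 1 <= C * fdot x (L *m x).
    rewrite /C mulrDl mul1r -mulrA; apply: (le_trans h2).
    rewrite -[leLHS]addr0; apply: lerD => //.
    by apply: ler_wpM2l => //; rewrite exprn_ge0 ?frob_ge0.
  suff: C^-1 <= fdot x (N *m x) - inf S by rewrite lerBrDl.
  move: h4; rewrite mulrC -ler_pdivrMr // mul1r /L.
  by rewrite mulmxBl mul_scalar_mx !fdot_lin x1 mulr1.
by rewrite gerDl leNgt invr_gt0 C0.
Qed.

Lemma eigenvalue_ge n (N : 'M[R]_n) k a :
  N^T = N -> psd (N - k%:M) -> eigenvalue N a -> k <= a.
Proof.
move=> sN pk /(eigenvalue_symP _ sN)[x Nx x0].
have := pk _ x; rewrite mulmxBl mul_scalar_mx Nx !fdot_lin -mulrBl pmulr_lge0 ?subr_ge0 //.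
by rewrite lt_def fdot_ge0 andbT; apply: contra_neq x0 => /fdot_eq0.
Qed.

(** The eigenvalue found by [rayleigh_min] bounds all others from below, so the infimum defining
    [lambda_min] is attained there. *)
Lemma lambda_min_psd n (N : 'M[R]_n) : (0 < n)%N -> N^T = N ->
  eigenvalue N (lambda_min N) /\ psd (N - (lambda_min N)%:M).
Proof.
move=> n0 sN; have [mu eN pN] := rayleigh_min n0 sN.
suff -> : lambda_min N = mu by [].
have lb : lbound [set a : R | eigenvalue N a]%classic mu.
  by move=> a /(eigenvalue_ge sN pN).
apply/le_anti/andP; split; first by apply: ge_inf => //; exists mu.
by apply: lb_le_inf => //; exists mu.
Qed.

(** Apply [rayleigh_min] to [- N], whose spectrum is the negated spectrum of [N]. *)
Lemma lambda_max_psd n (N : 'M[R]_n) : (0 < n)%N -> N^T = N ->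
  psd ((lambda_max N)%:M - N).
Proof.
move=> n0 sN; have sN' : (- N)^T = - N by rewrite linearN /= sN.
have eN a (M := N) : eigenvalue (- M) a = eigenvalue M (- a).
  apply/(eigenvalue_symP _ sN')/(eigenvalue_symP _ sN) => -[x Nx x0]; exists x => //.
    by rewrite scaleNr -Nx mulNmx opprK.
  by rewrite mulNmx Nx scaleNr opprK.
have [mu e1 pN] := rayleigh_min n0 sN'.
have ub : ubound [set a : R | eigenvalue N a]%classic (- mu).
  by move=> a /= ea; rewrite lerNr (eigenvalue_ge sN' pN) // eN opprK.
have h : - mu <= lambda_max N.
  by apply: ub_le_sup; [exists (- mu)|rewrite /= -eN].
move=> m B; have := pN _ B; rewrite !mulmxBl mulNmx !mul_scalar_mx !fdot_lin.
have := fdot_ge0 B; nra.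
Qed.

Lemma posdef_lambda_min_gt0 n (N : 'M[R]_n) : (0 < n)%N -> posdef N -> 0 < lambda_min N.
Proof.
move=> n0 [sN pN]; have [/(eigenvalue_symP _ sN)[x Nx x0] _] := lambda_min_psd n0 sN.
have := pN x x0; rewrite -mulmxA Nx -trace_mx11 -/(fdot x _) fdotZr.
by rewrite pmulr_lgt0 // lt_def fdot_ge0 andbT; apply: contra_neq x0 => /fdot_eq0.
Qed.

Lemma posdef_psd n (N : 'M[R]_n) : posdef N -> psd N.
Proof.
move=> [sN pN]; apply: psd_cols => x.
have [->|/pN/ltW] := eqVneq x 0; first by rewrite /fdot !mulmx0 mxtrace0.
by rewrite -mulmxA -trace_mx11.
Qed.

(** * The spectral norm as an operator bound *)

Lemma vnorm2_frob n (x : 'cV[R]_n) : vnorm2 x = frob x.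
Proof. by congr Num.sqrt; apply: eq_bigr => i _; rewrite big_ord1. Qed.

Lemma specnorm_has_sup m n (A : 'M[R]_(m, n)) :
  has_sup [set vnorm2 (A *m x) | x in [set x : 'cV[R]_n | vnorm2 x <= 1]]%classic.
Proof.
split; first by exists (vnorm2 (A *m 0)); exists 0 => //=;
  rewrite vnorm2_frob frobE /fdot mulmx0 mxtrace0 sqrtr0.
exists (frob A) => _ [x /= x1 <-]; rewrite vnorm2_frob (le_trans (frob_mul_col _ _)) //.
by rewrite -[leRHS]mulr1 ler_wpM2l ?frob_ge0 // -vnorm2_frob.
Qed.

Lemma specnorm_ge0 m n (A : 'M[R]_(m, n)) : 0 <= specnorm A.
Proof.
have [_ h] := specnorm_has_sup A; apply: (le_trans (frob_ge0 (A *m (0 : 'cV_n)))).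
rewrite -vnorm2_frob; apply: ub_le_sup => //; exists 0 => //=.
by rewrite vnorm2_frob frobE /fdot mulmx0 mxtrace0 sqrtr0.
Qed.

(** The bound [|A x| <= specnorm A * |x|], obtained by scaling [x] to the unit ball, written as a
    form inequality so that it extends to matrix arguments. *)
Lemma specnorm_psd m n (A : 'M[R]_(m, n)) : psd ((specnorm A ^+ 2)%:M - A^T *m A).
Proof.
apply: psd_cols => x; rewrite mulmxBl mul_scalar_mx !fdot_lin subr_ge0.
rewrite -mulmxA -{1}[A]trmxK -fdot_mull trmxK -!frob_sq -exprMn.
rewrite ler_sqr ?nnegrE ?mulr_ge0 ?frob_ge0 ?specnorm_ge0 //.
have := frob_ge0 x; rewrite le_eqVlt => /predU1P[x0|x0].
  have -> : x = 0 by apply: fdot_eq0; rewrite -frob_sq -x0 expr0n.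
  by rewrite mulmx0 frobE /fdot mulmx0 mxtrace0 sqrtr0 mulr_ge0 ?frob_ge0 ?specnorm_ge0.
rewrite -ler_pdivrMr //.
have [_ h] := specnorm_has_sup A.
have -> : frob (A *m x) / frob x = vnorm2 (A *m ((frob x)^-1 *: x)).
  rewrite vnorm2_frob -scalemxAr !frobE !fdot_lin mulrA -expr2 -!frobE sqrtrM ?sqr_ge0 //.
  by rewrite sqrtr_sqr ger0_norm ?invr_ge0 ?frob_ge0 // mulrC -frobE.
apply: ub_le_sup => //; exists ((frob x)^-1 *: x) => //=.
rewrite vnorm2_frob frobE !fdot_lin -frob_sq mulrA -expr2 exprVn mulVf ?sqrtr1 //.
by rewrite sqrf_eq0 gt_eqF.
Qed.

Lemma frob_mul_specnorm m n p (A : 'M[R]_(m, n)) (B : 'M_(n, p)) :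
  frob (A *m B) <= specnorm A * frob B.
Proof.
apply: frob_le; rewrite ?specnorm_ge0 //.
have := specnorm_psd A B; rewrite mulmxBl mul_scalar_mx !fdot_lin subr_ge0.
by rewrite fdot_mull mulmxA.
Qed.

End Spectrum.

(** * Perturbation of orthonormal frames and of the matrices they carry *)

Section Subspaces.
Variable R : realType.

(** By Pythagoras both squares equal [n - |V^T U|^2]. *)
Lemma frob_proj_sym m n (U V : 'M[R]_(m, n)) :
  U^T *m U = 1%:M -> V^T *m V = 1%:M ->
  frob (U - V *m (V^T *m U)) = frob (V - U *m (U^T *m V)).
Proof.
move=> hU hV; have := fdot_proj U hV; have := fdot_proj V hU.
have -> : fdot (U^T *m V) (U^T *m V) = fdot (V^T *m U) (V^T *m U).
  by rewrite -fdot_tr !trmx_mul !trmxK.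
have -> : fdot U U = fdot V V by rewrite /fdot hU hV.
by move=> <- /addIr h; rewrite !frobE h.
Qed.

(** Pair [D X + Y D] with [D]: the first term contributes at least [0], the second at least
    [c |D|^2]; conclude by Cauchy-Schwarz. *)
Lemma frob_sylvester n (X Y D : 'M[R]_n) c :
  X^T = X -> psd X -> psd (Y - c%:M) -> c * frob D <= frob (D *m X + Y *m D).
Proof.
move=> sX pX /(_ _ D); rewrite mulmxBl mul_scalar_mx !fdot_lin => hY.
have hX : 0 <= fdot D (D *m X) by rewrite -fdot_tr trmx_mul sX.
have := fdot_cauchy D (D *m X + Y *m D); rewrite fdotDr => h.
have := frob_ge0 D; rewrite le_eqVlt => /predU1P[b0|b0].
  by rewrite -b0 mulr0 frob_ge0.
rewrite -(ler_pM2l b0) mulrCA -expr2 frob_sq; lra.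
Qed.

(* With [V = U0^T U] and [F = U - U0 V], the symmetry of [X] and [Y] gives
   [X = Y V + C^T F = V^T Y + (C^T F)^T], hence the Sylvester equation
   [(1 - V) X + Y (1 - V) = C^T F - V (C^T F)^T + (1 - V V^T) Y]. *)
Lemma frob_sub_aligned m n (C U U0 : 'M[R]_(m, n)) c :
  C^T *m C = 1%:M -> U^T *m U = 1%:M -> U0^T *m U0 = 1%:M ->
  (C^T *m U)^T = C^T *m U -> (C^T *m U0)^T = C^T *m U0 ->
  psd (C^T *m U) -> psd (C^T *m U0 - c%:M) -> c <= 1 ->
  c * frob (U - U0) <= 4 * frob (U0 - U *m (U^T *m U0)).
Proof.
move=> hC hU hU0; set X := C^T *m U; set Y := C^T *m U0 => sX sY pX pY c1.
set E := U0 - _; set V := U0^T *m U; set F := U - U0 *m V.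
have EF : frob E = frob F by rewrite frob_proj_sym.
have [c0|c0] := leP c 0.
  by apply: (@le_trans _ _ 0); rewrite ?mulr_ge0 ?mulr_le0_ge0 ?frob_ge0.
have F1 : C^T *m F = X - Y *m V by rewrite mulmxBr !mulmxA.
have F1T : (C^T *m F)^T = X - V^T *m Y by rewrite F1 linearB /= sX [(Y *m V)^T]trmx_mul sY.
have hS : (1%:M - V) *m X + Y *m (1%:M - V) =
    C^T *m F - V *m (C^T *m F)^T + U0^T *m (E *m Y).
  have -> : U0^T *m (E *m Y) = Y - V *m (V^T *m Y).
    by rewrite mulmxA mulmxBr hU0 mulmxBl mul1mx trmx_mul trmxK !mulmxA.
  have gen (x y v : 'M[R]_n) : (1%:M - v) *m x + y *m (1%:M - v) =
      x - y *m v - v *m (x - v^T *m y) + (y - v *m (v^T *m y)).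
    rewrite mulmxBl !mulmxBr mul1mx mulmx1.
    by apply/matrixP => i j; rewrite !mxE; ring.
  by rewrite F1T F1; exact: gen.
have h1 : frob (C^T *m F) <= frob F by exact: frob_coisom.
have h2 : frob (V *m (C^T *m F)^T) <= frob F.
  by rewrite -mulmxA (le_trans (frob_coisom _ hU0)) // frob_isom // frob_tr.
have h3 : frob (U0^T *m (E *m Y)) <= frob E.
  apply: le_trans (frob_coisom _ hU0) _; rewrite frob_mulr trmx_mul trmxK -mulmxA.
  by rewrite (le_trans (frob_coisom _ hU0)) // frob_isom // frob_tr.
have h4 : c * frob (1%:M - V) <= 3 * frob E.
  apply: le_trans (frob_sylvester _ sX pX pY) _; rewrite hS.
  apply: le_trans (frobD _ _) _; have := frobB (C^T *m F) (V *m (C^T *m F)^T).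
  rewrite EF in h3 *; lra.
have h5 : frob (U - U0) <= frob (1%:M - V) + frob F.
  have -> : U - U0 = - (U0 *m (1%:M - V)) + F.
    by rewrite mulmxBr mulmx1 opprB [RHS]addrC addrA subrK.
  by apply: le_trans (frobD _ _) _; rewrite frobN frob_isom.
(* The three error terms of the Sylvester equation give [3]; [c |F| <= |E|] supplies the fourth
   unit. *)
have := frob_ge0 F; rewrite EF in h4 *; nra.
Qed.

(** Since [U U^T] fixes [S], one has [E M0 = - (1 - U U^T) (S - S0) U0], of norm at most [|S - S0|],
    while [M0 >= k] gives [k |E| <= |E M0|]. *)
Lemma frob_off_range m n (U U0 : 'M[R]_(m, n)) (M M0 : 'M_n) k :
  U^T *m U = 1%:M -> U0^T *m U0 = 1%:M -> M0^T = M0 -> psd (M0 - k%:M) ->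
  k * frob (U0 - U *m (U^T *m U0)) <= frob (U *m M *m U^T - U0 *m M0 *m U0^T).
Proof.
move=> hU hU0 sM0 pM0; rewrite -(frob_tr (U0 - _)).
apply: le_trans (frob_psd_ge _ pM0) _; rewrite -{1}sM0 -trmx_mul frob_tr.
set S := _ *m U^T; set S0 := _ *m U0^T; set E := U0 - _.
have -> : E *m M0 = - ((S - S0) - U *m (U^T *m (S - S0))) *m U0.
  have e1 : U *m (U^T *m S) = S by rewrite !mulmxA -(mulmxA U) hU mulmx1.
  have e2 : S0 *m U0 = U0 *m M0 by rewrite -mulmxA hU0 mulmx1.
  rewrite /E; move: (S) (S0) e1 e2 => s s0 e1 e2.
  rewrite !(mulmxBr, mulNmx, mulmxBl) e1 -!mulmxA e2.
  by apply/matrixP => i j; rewrite !mxE; ring.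
rewrite mulNmx frobN frob_mulr (le_trans (frob_coisom _ hU0)) // frob_tr.
exact: frob_coproj.
Qed.

Lemma frob_core m n (U U0 : 'M[R]_(m, n)) (M M0 : 'M_n) k :
  U^T *m U = 1%:M -> U0^T *m U0 = 1%:M -> M0^T = M0 -> psd M0 -> psd (k%:M - M0) ->
  0 <= k ->
  frob (M - M0) <= frob (U *m M *m U^T - U0 *m M0 *m U0^T) + 2 * k * frob (U - U0).
Proof.
move=> hU hU0 sM0 pM0 pk k0; set S := _ *m U^T; set S0 := _ *m U0^T.
(* Telescoping of [U^T S U - U0^T S0 U0] through [U^T S0 U] and [U^T S0 U0]; each of the last two
   terms costs [k |U - U0|]. *)
have -> : M - M0 = U^T *m (S - S0) *m U + U^T *m (U0 *m (M0 *m (U0^T *m (U - U0))))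
    + (U - U0)^T *m (U0 *m M0).
  have e1 : U^T *m S *m U = M by rewrite !mulmxA hU mul1mx -mulmxA hU mulmx1.
  have e3 : U0 *m (M0 *m (U0^T *m (U - U0))) = S0 *m U - U0 *m M0.
    by rewrite mulmxBr hU0 !mulmxBr mulmx1 !mulmxA.
  rewrite e3; move: (S) (S0) e1 => s s0 e1.
  rewrite [(U - U0)^T]linearB /= !(mulmxBr, mulmxBl) e1 (mulmxA U0^T) hU0 mul1mx !mulmxA.
  by apply/matrixP => i j; rewrite !mxE; ring.
have h1 : frob (U^T *m (S - S0) *m U) <= frob (S - S0).
  by rewrite -mulmxA (le_trans (frob_coisom _ hU)) // frob_mulr
     (le_trans (frob_coisom _ hU)) // frob_tr.
have h2 : frob (U^T *m (U0 *m (M0 *m (U0^T *m (U - U0))))) <= k * frob (U - U0).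
  rewrite (le_trans (frob_coisom _ hU)) // frob_isom //.
  by rewrite (le_trans (frob_psd_le _ sM0 pM0 pk k0)) // ler_wpM2l // frob_coisom.
have h3 : frob ((U - U0)^T *m (U0 *m M0)) <= k * frob (U - U0).
  rewrite frob_mulr trmxK trmx_mul sM0 -mulmxA.
  by rewrite (le_trans (frob_psd_le _ sM0 pM0 pk k0)) // ler_wpM2l // frob_coisom.
apply: le_trans (frobD _ _) _; have := frobD (U^T *m (S - S0) *m U)
  (U^T *m (U0 *m (M0 *m (U0^T *m (U - U0))))); lra.
Qed.

End Subspaces.

(** * Block form and bounds for the Cayley parameterization *)

Section Cayley.
Variables (R : realType) (r q : nat).
Implicit Types A : 'M[R]_(q, r).

Lemma Ipr_isom : (Ipr R r q)^T *m Ipr R r q = 1%:M.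
Proof. by rewrite /Ipr tr_col_mx mul_row_col trmx0 mulmx0 addr0 trmx1 mulmx1. Qed.

Lemma Ipr_usubmx n (U : 'M[R]_(r + q, n)) : (Ipr R r q)^T *m U = usubmx U.
Proof. by rewrite -{1}[U]vsubmxK /Ipr tr_col_mx mul_row_col trmx0 trmx1 mul1mx mul0mx addr0. Qed.

Lemma frob_usubmx n (U : 'M[R]_(r + q, n)) : frob (usubmx U) <= frob U.
Proof. by rewrite -Ipr_usubmx frob_coisom // Ipr_isom. Qed.

Lemma frob_dsubmx n (U : 'M[R]_(r + q, n)) : frob (dsubmx U) <= frob U.
Proof.
rewrite !frobE ler_sqrt ?fdot_ge0 //.
have -> : fdot U U = fdot (usubmx U) (usubmx U) + fdot (dsubmx U) (dsubmx U).
  by rewrite -{1 2}[U]vsubmxK /fdot tr_col_mx mul_row_col mxtraceD.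
by rewrite lerDr fdot_ge0.
Qed.

Definition gram_inv A : 'M[R]_r := invmx (1%:M + A^T *m A).

Lemma fdot_gram A n (B : 'M_(r, n)) : fdot B (A^T *m A *m B) = fdot (A *m B) (A *m B).
Proof. by rewrite fdot_mull mulmxA. Qed.

Lemma gram_unit A : 1%:M + A^T *m A \in unitmx.
Proof.
apply: unitmx_coercive => x; rewrite mulmxDl mul1mx fdotDr fdot_gram.
by rewrite lerDl fdot_ge0.
Qed.

Lemma gram_invE A : A^T *m A *m gram_inv A = 1%:M - gram_inv A.
Proof.
by rewrite -(mulmxV (gram_unit A)) mulmxDl mul1mx addrAC subrr add0r.
Qed.

Lemma gram_inv_sym A : (gram_inv A)^T = gram_inv A.
Proof. by rewrite trmx_inv linearD /= trmx1 trmx_mul trmxK. Qed.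

(** Skew-symmetry gives [<x, Xphi A x> = 0], so [1 - Xphi A] is coercive. *)
Lemma Xphi_skew_unit A : 1%:M - Xphi A \in unitmx.
Proof.
have sX : (Xphi A)^T = - Xphi A.
  by rewrite tr_block_mx opp_block_mx linearN /= trmxK !trmx0 !oppr0 opprK.
apply: unitmx_coercive => x; rewrite mulmxBl mul1mx fdotDr fdotNr lerDl.
have : fdot x (Xphi A *m x) = - fdot x (Xphi A *m x).
  by rewrite {1}fdotC fdot_mull sX mulNmx fdotNr.
lra.
Qed.

Lemma UcayE A : Ucay A = col_mx (2 *: gram_inv A - 1%:M) (2 *: (A *m gram_inv A)).
Proof.
set K := gram_inv A.
(* Solving this block system replaces the inverse of size [r + q] by the [r]-by-[r] inverse [K]. *)
have e : (1%:M - Xphi A) *m col_mx K (A *m K) = Ipr R r q.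
  rewrite /Xphi scalar_mx_block opp_block_mx add_block_mx mul_block_col.
  rewrite !oppr0 !addr0 !add0r opprK !mul1mx mulNmx addNr.
  by rewrite mulmxA gram_invE addrC subrK.
rewrite /Ucay -mulmxA -e mulKmx ?Xphi_skew_unit //.
rewrite /Xphi scalar_mx_block add_block_mx mul_block_col !addr0 !add0r !mul1mx.
rewrite mulNmx mulmxA gram_invE opprB addrCA.
by congr col_mx; rewrite scaler_nat mulr2n // addrA.
Qed.

Lemma usubmx_Ucay A : usubmx (Ucay A) = 2 *: gram_inv A - 1%:M.
Proof. by rewrite UcayE col_mxKu. Qed.

Lemma usubmx_Ucay_sym A : (usubmx (Ucay A))^T = usubmx (Ucay A).
Proof. by rewrite usubmx_Ucay linearB linearZ /= gram_inv_sym trmx1. Qed.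

(** Reduces to [(2 K - 1)^2 + 4 (K - K^2) = 1]. *)
Lemma Ucay_isom A : (Ucay A)^T *m Ucay A = 1%:M.
Proof.
have := usubmx_Ucay_sym A; rewrite usubmx_Ucay UcayE tr_col_mx mul_row_col => ->.
set K := gram_inv A; have -> : (2 *: (A *m K))^T = 2 *: (A *m K)^T by rewrite linearZ.
rewrite -scalemxAl -scalemxAr.
have -> : (A *m K)^T *m (A *m K) = K - K *m K.
  by rewrite trmx_mul gram_inv_sym -mulmxA (mulmxA A^T) gram_invE mulmxBr mulmx1.
rewrite mulmxBl mulmxBr mulmx1 mul1mx -scalemxAl -scalemxAr.
by apply/matrixP => i j; rewrite !mxE; ring.
Qed.

(** Substituting [B = (1 + G) y] with [G = A^T A] removes the inverse and avoids singular values.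
    What remains is a combination of [a |y|^2 - <y, G y>] and [a <y, G y> - |G y|^2], both
    nonnegative because [0 <= G <= a]. *)
Lemma usubmx_Ucay_psd A : specnorm A < 1 ->
  psd (usubmx (Ucay A) - ((1 - specnorm A ^+ 2) / (1 + specnorm A ^+ 2))%:M).
Proof.
set a := _ ^+ 2 => A1 m B; have a0 : 0 <= a by exact: sqr_ge0.
pose G := A^T *m A; pose y := gram_inv A *m B.
have By : B = y + G *m y by rewrite -{1}[y]mul1mx -mulmxDl mulKVmx ?gram_unit.
have sG : G^T = G by rewrite trmx_mul trmxK.
have pG : psd G by move=> k C; rewrite fdot_gram fdot_ge0.
have pa : psd (a%:M - G) by exact: specnorm_psd.
have h1 := psd_sq_le y sG pG pa.
have h0 := pa _ y; rewrite mulmxBl mul_scalar_mx !fdot_lin in h0.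
have h00 := fdot_ge0 y.
rewrite usubmx_Ucay !mulmxBl -scalemxAl mul1mx mul_scalar_mx -/y !fdot_lin {1 2 3 4 5}By !fdot_lin.
rewrite (fdotC (G *m y) y); move: h1 h0 h00.
move: (fdot y y) (fdot y (G *m y)) (fdot (G *m y) (G *m y)) => g0 g1 g2 h1 h0 h00.
have -> : 2 * (g0 + g1) - (g0 + g1 + (g1 + g2))
    - (1 - a) / (1 + a) * (g0 + g1 + (g1 + g2))
    = (2 * (a * g0 - g1) + 2 * (a * g1 - g2)) / (1 + a).
  by field; lra.
by apply: divr_ge0; lra.
Qed.

Lemma usubmx_Ucay_psd0 A : specnorm A < 1 -> psd (usubmx (Ucay A)).
Proof.
move=> A1 m B; have := usubmx_Ucay_psd A1 B.
rewrite mulmxBl mul_scalar_mx !fdot_lin subr_ge0; apply: le_trans.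
have a1 : specnorm A ^+ 2 <= 1 by rewrite expr_le1 ?specnorm_ge0 // ltW.
by rewrite mulr_ge0 ?fdot_ge0 // divr_ge0 ?subr_ge0 // addr_ge0 ?sqr_ge0.
Qed.

(* [A] is recovered from [U] through [A (1 + U_1) = U_2]. *)
Lemma frob_Ucay_inv A A0 : specnorm A < 1 -> specnorm A0 < 1 ->
  frob (A - A0) <= 2 * frob (Ucay A - Ucay A0).
Proof.
move=> A1 A01; set D := Ucay A - _.
have e (B : 'M[R]_(q, r)) : B *m (1%:M + usubmx (Ucay B)) = dsubmx (Ucay B).
  by rewrite UcayE col_mxKu col_mxKd addrC subrK -scalemxAr.
have eD : (A - A0) *m (1%:M + usubmx (Ucay A)) = dsubmx D - A0 *m usubmx D.
  have -> : usubmx D = usubmx (Ucay A) - usubmx (Ucay A0) by rewrite linearB.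
  have -> : dsubmx D = dsubmx (Ucay A) - dsubmx (Ucay A0) by rewrite linearB.
  rewrite -!e mulmxBl !mulmxBr !mulmxDr.
  by apply/matrixP => i j; rewrite !mxE; ring.
(* As [1 + U_1 >= 1], right multiplication by it does not shrink the norm of [A - A0]. *)
have p1 : psd (1%:M + usubmx (Ucay A) - 1%:M).
  by rewrite addrAC subrr add0r; apply: usubmx_Ucay_psd0.
have := frob_psd_ge (A - A0)^T p1; rewrite mul1r frob_tr => h.
apply: le_trans h _; rewrite -frob_tr trmx_mul trmxK linearD /= trmx1 usubmx_Ucay_sym eD.
apply: le_trans (frobB _ _) _; rewrite mulr2n mulrDl mul1r lerD ?frob_dsubmx //.
apply: le_trans (frob_mul_specnorm _ _) _; rewrite -[leRHS]mul1r.
by rewrite ler_pM ?specnorm_ge0 ?frob_ge0 ?frob_usubmx // ltW.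
Qed.

End Cayley.

(** * Parameter vectors as lists *)

Section Theta.
Variable R : realType.

Lemma zip_sub_flatten (I J : Type) (s : seq I) (t : I -> seq J) (f g : I -> J -> R) :
  [seq x.1 - x.2 | x <- zip (flatten [seq [seq f i j | j <- t i] | i <- s])
                            (flatten [seq [seq g i j | j <- t i] | i <- s])]
  = flatten [seq [seq f i j - g i j | j <- t i] | i <- s].
Proof.
elim: s => //= i s IH; rewrite zip_cat ?size_map // map_cat IH; congr (_ ++ _).
by elim: (t i) => //= j u ->.
Qed.

Lemma theta_of_sub r q (A B : 'M[R]_(q, r)) (M N : 'M_r) :
  [seq x.1 - x.2 | x <- zip (theta_of A M) (theta_of B N)] = theta_of (A - B) (M - N).
Proof.
rewrite /theta_of zip_cat; last by rewrite !size_allpairs.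
rewrite map_cat !zip_sub_flatten; congr (_ ++ _).
  by congr flatten; apply: eq_map => j; apply: eq_map => i; rewrite !mxE.
by congr flatten; apply: eq_map => j; apply: eq_map => i; rewrite !mxE.
Qed.

(** [vech] keeps only part of the entries, so its squares sum to at most [|M|^2]; then
    [a^2 + b^2 <= (a + b)^2]. *)
Lemma seqnorm2_theta_of r q (A : 'M[R]_(q, r)) (M : 'M_r) :
  seqnorm2 (theta_of A M) <= frob A + frob M.
Proof.
rewrite -[leRHS]ger0_norm ?addr_ge0 ?frob_ge0 // -sqrtr_sqr ler_wsqrtr //.
suff : \sum_(a <- theta_of A M) a ^+ 2 <= frob A ^+ 2 + frob M ^+ 2.
  by move/le_trans; apply; have := frob_ge0 A; have := frob_ge0 M; nra.
rewrite !frob_sq !fdotE big_cat /= lerD //.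
  rewrite big_allpairs_dep /= exchange_big /= !big_enum /=.
  by apply: ler_sum => i _; rewrite big_enum.
rewrite big_flatten big_map big_enum exchange_big /=; apply: ler_sum => j _.
rewrite big_map big_filter big_enum_cond big_mkcond; apply: ler_sum => i _.
by rewrite -expr2; case: ifP => // _; rewrite sqr_ge0.
Qed.

End Theta.

(** * Assembling the estimates *)

Theorem theorem4 (R : realType) (r q : nat) (hr : (1 <= r)%N)
  (A A0 : 'M[R]_(q, r)) (M M0 : 'M[R]_r)
  (hA : specnorm A < 1) (hA0 : specnorm A0 < 1)
  (hM : posdef M) (hM0 : posdef M0) :
  let a0 := specnorm A0 ^+ 2 in
  frob (Sigma A M - Sigma A0 M0)
    <= (1 - a0) ^+ 2 * lambda_min M0 / (4 * Num.sqrt 2 * (1 + a0) ^+ 2) ->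
  seqnorm2 [seq x.1 - x.2 | x <- zip (theta_of A M) (theta_of A0 M0)]
    <= (1 + 16 * Num.sqrt 2 * (1 + lambda_max M0) * (1 + a0)
             / (lambda_min M0 * (1 - a0))) * frob (Sigma A M - Sigma A0 M0).
Proof.
move=> a0 _; have sM0 := hM0.1.
have U1 := Ucay_isom A; have U01 := Ucay_isom A0.
have [_ pmin] := lambda_min_psd hr sM0.
have l0 := posdef_lambda_min_gt0 hr hM0.
have pmax := lambda_max_psd hr sM0.
(* An eigenvector for [lambda_min M0], tested in [pmax], shows [lambda_min M0 <= lambda_max M0]. *)
have L0 : 0 <= lambda_max M0.
  have [emin _] := lambda_min_psd hr sM0; apply: le_trans (ltW l0) _.
  move/(eigenvalue_symP _ sM0): emin => [x Mx x0].
  have := pmax _ x; rewrite mulmxBl mul_scalar_mx Mx !fdot_lin -mulrBl.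
  by rewrite pmulr_lge0 ?subr_ge0 // lt_def fdot_ge0 andbT; apply: contra_neq x0 => /fdot_eq0.
have a_ge0 : 0 <= a0 by exact: sqr_ge0.
have a_lt1 : a0 < 1 by rewrite expr_lt1 ?specnorm_ge0.
have := frob_off_range M U1 U01 sM0 pmin.
have := frob_core M U1 U01 sM0 (posdef_psd hM0) pmax L0.
rewrite -/(Sigma A M) -/(Sigma A0 M0); set d := frob (_ - Sigma A0 M0) => hcore hoff.
have := @frob_sub_aligned R _ _ (Ipr R r q) _ _ ((1 - a0) / (1 + a0)) (Ipr_isom _ _ _) U1 U01.
rewrite !Ipr_usubmx !usubmx_Ucay_sym => /(_ erefl erefl (usubmx_Ucay_psd0 hA) (usubmx_Ucay_psd hA0)).
move: hoff hcore (frob_Ucay_inv hA hA0).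
rewrite theta_of_sub => hoff hcore hinv hal.
apply: le_trans (seqnorm2_theta_of _ _) _.
move: hoff hcore hinv hal.
move: (frob (A - A0)) (frob (M - M0)) (frob (Ucay A - Ucay A0)) (frob (_ - _ *m _)).
move=> dA dM dU e hoff hcore hinv hal.
have d0 : 0 <= d by exact: frob_ge0.
have s1 : 1 <= Num.sqrt (2 : R) by rewrite -[leLHS]sqrtr1 ler_wsqrtr // ler1n.
have c1 : (1 - a0) / (1 + a0) <= 1 by rewrite ler_pdivrMr; lra.
have {}hal := hal c1.
(* Chains [c dU <= 4 e] with [lambda_min M0 * e <= d]. *)
have hU : dU <= 4 * (1 + a0) / (lambda_min M0 * (1 - a0)) * d.
  have P : 0 < lambda_min M0 * (1 - a0) by rewrite mulr_gt0 // subr_gt0.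
  rewrite mulrAC ler_pdivlMr //.
  have : (1 - a0) * dU <= 4 * e * (1 + a0).
    by rewrite mulrAC ler_pdivrMr in hal => //; lra.
  nra.
set k := (1 + a0) / (lambda_min M0 * (1 - a0)).
have k0 : 0 <= k by rewrite divr_ge0 ?mulr_ge0 ?subr_ge0 ?addr_ge0 // ltW.
have {}hU : dU <= 4 * (k * d) by rewrite /k; move: hU; rewrite !mulrA.
have kd0 : 0 <= k * d by rewrite mulr_ge0.
rewrite (_ : (1 + _) * d = d + 16 * (Num.sqrt 2 * ((1 + lambda_max M0) * (k * d)))); last first.
  by rewrite mulrDl mul1r /k !mulrA.
(* The total is at most [d + 2 (1 + lambda_max M0) dU], hence at most
   [d + 8 (1 + lambda_max M0) k d]; [1 <= Num.sqrt 2] then reaches the stated constant. *)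
have h : (1 + lambda_max M0) * (k * d) <= Num.sqrt 2 * ((1 + lambda_max M0) * (k * d)).
  by rewrite ler_peMl // mulr_ge0 // addr_ge0.
have h1 : (1 + lambda_max M0) * dU <= (1 + lambda_max M0) * (4 * (k * d)).
  by rewrite ler_wpM2l // addr_ge0.
have h2 : 0 <= (1 + lambda_max M0) * (k * d) by rewrite mulr_ge0 ?addr_ge0.
lra.
Qed.
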